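(* Let $G$ be a finite simple graph with vertex set $\{x_1,\ldots,x_n\}$ and let $H=C(G)$ be the cone over $G$, with new vertex $x_{n+1}$. Let $\alpha=(a_1,\ldots,a_n,-b)$, with $a_i\in\mathbb{N}$ and $b\in\mathbb{N}$, be any of the vectors $\alpha_1,\ldots,\alpha_p$ occurring in the irreducible representation of the Rees cone $\mathbb{R}_+(I_c(G))$, and set $$\beta_i=a_i\ (1\leq i\leq n),\qquad \beta_{n+1}=\Big(\sum_{i=1}^n a_i\Big)-b,\qquad \beta_{n+2}=\sum_{i=1}^n a_i.$$ If $a_i\geq 1$ for all $i$, then $x_1^{\beta_1}\cdots x_{n+1}^{\beta_{n+1}}t^{\beta_{n+2}}$ is a minimal generator of the symbolic Rees algebra $R_s(I(H))$ as a $K$-algebra.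
   Context: $\mathbb{N}=\{0,1,2,\ldots\}$ and $K$ is a field. The cone $C(G)$ over $G$ is the graph obtained by adding a new vertex to $G$ and joining it to every vertex of $G$. A vertex cover of a graph is a set of vertices meeting every edge. Let $u_1,\ldots,u_s\in\{0,1\}^n$ be the incidence vectors of the (inclusion-)minimal vertex covers of $G$. The ideal of vertex covers $I_c(G)\subset K[x_1,\ldots,x_n]$ is generated by $x^{u_1},\ldots,x^{u_s}$, and its Rees cone $\mathbb{R}_+(I_c(G))\subset\mathbb{R}^{n+1}$ is the cone of nonnegative real combinations of $e_1,\ldots,e_n,(u_1,1),\ldots,(u_s,1)$; it has dimension $n+1$. There is a unique irreducible representation $$\mathbb{R}_+(I_c(G))=H_{e_1}^+\cap\cdots\cap H_{e_{n+1}}^+\cap H_{\alpha_1}^+\cap\cdots\cap H_{\alpha_p}^+$$ where $H_c^+=\{y\in\mathbb{R}^{n+1}\mid\langle y,c\rangle\geq 0\}$, each $\alpha_k\in\mathbb{Z}^{n+1}$ has relatively prime nonzero entries, and none of the closed halfspaces can be omitted. That is, $\alpha_1,\ldots,\alpha_p$ are the primitive integral inner normal vectors of the facets of the cone other than those lying in coordinate hyperplanes. Each $\alpha_k$ has the form $(a_1,\ldots,a_n,-b)$ with $a_i,b\in\mathbb{N}$. For a graph $H$ with vertices $x_1,\ldots,x_m$, the edge ideal $I(H)\subset R=K[x_1,\ldots,x_m]$ is generated by all $x_ix_j$ with $\{x_i,x_j\}\in E(H)$; its $i$th symbolic power is $I(H)^{(i)}=\mathfrak{p}_1^i\cap\cdots\cap\mathfrak{p}_s^i$,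 where $\mathfrak{p}_1,\ldots,\mathfrak{p}_s$ are the minimal primes of $I(H)$, and $R_s(I(H))=\bigoplus_{i\geq 0}I(H)^{(i)}t^i\subset R[t]$ (with $I(H)^{(0)}=R$). This is a $K$-algebra spanned by monomials; its minimal generators are the monomials $\neq 1$ in $R_s(I(H))$ that are not a product of two monomials $\neq 1$ of $R_s(I(H))$. *)

(* Defs.v *)
From HB Require Import structures.
From mathcomp Require Import all_boot all_order all_algebra.
From mathcomp Require Import boolp classical_sets reals.
From mathcomp Require Import mpoly.

Set Implicit Arguments.
Unset Strict Implicit.
Unset Printing Implicit Defensive.

Import Order.TTheory GRing.Theory Num.Theory.
Local Open Scope classical_set_scope.
Local Open Scope ring_scope.

(* Throughout, x_1, ..., x_n are indexed by 'I_n, and 'I_n.+1 is viewed as 'I_n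
   (through lift ord_max, which preserves the underlying nat) together with one
   new last index ord_max. *)

Definition extend (T : Type) (n : nat) (v : 'I_n -> T) (x : T) : 'I_n.+1 -> T :=
  fun j => oapp v x (unlift ord_max j).

(* Simple graphs on 'I_n are symmetric irreflexive relations. *)

Definition cone_graph (n : nat) (G : rel 'I_n) : rel 'I_n.+1 := fun i j =>
  match unlift ord_max i, unlift ord_max j with
  | Some a, Some b => G a b
  | None, None => false
  | _, _ => true
  end.

Definition vertex_cover (n : nat) (G : rel 'I_n) : pred {set 'I_n} := fun C =>
  [forall i, forall j, G i j ==> ((i \in C) || (j \in C))].

Definition min_cover_vectors (n : nat) (G : rel 'I_n) : seq 'X_{1..n} :=
  [seq [multinom (i \in C : nat) | i < n]
     | C : {set 'I_n} <- enum [pred C | minset (vertex_cover G) C]].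

(* The cone generated by e_1, ..., e_n and the (u, 1) for u in us, that is, the
   Rees cone of the monomial ideal with generators x^u; the ideal itself enters
   only through us. *)
Definition rees_cone (R : realType) (n : nat) (us : seq 'X_{1..n}) :
    set 'rV[R]_n.+1 :=
  [set y | exists (c : 'I_n -> R) (d : 'X_{1..n} -> R),
      [/\ forall i, 0 <= c i, forall u, 0 <= d u &
          y = \sum_i c i *: delta_mx 0 (lift ord_max i)
            + \sum_(u <- us) d u *: \row_j extend (fun i => (u i)%:R) 1 j]].

Definition cover_rees_cone (R : realType) (n : nat) (G : rel 'I_n) :
    set 'rV[R]_n.+1 :=
  rees_cone (min_cover_vectors G).

Arguments cover_rees_cone R [n] G _.

Definition halfspace (R : realType) (m : nat) (c : 'rV[R]_m) : set 'rV[R]_m :=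
  [set y | 0 <= \sum_j y 0 j * c 0 j].

Definition halfspaces_inter (R : realType) (m : nat) (cs : seq 'rV[R]_m) :
    set 'rV[R]_m :=
  \bigcap_(c in [set c | c \in cs]) halfspace c.

Definition primitive_vector (m : nat) (alpha : 'rV[int]_m) : Prop :=
  \big[gcdn/0%N]_j absz (alpha 0 j) = 1%N.

(* [C] is the intersection of the H_{e_j}^+ (all j) and the H_alpha^+ (alpha in
   alphas), and none of these closed halfspaces can be omitted. *)
Definition irreducible_representation (R : realType) (m : nat)
    (C : set 'rV[R]_m) (alphas : seq 'rV[int]_m) : Prop :=
  let normals := [seq delta_mx 0 j | j <- enum 'I_m]
                 ++ [seq map_mx intr alpha | alpha <- alphas] in
  [/\ forall alpha, alpha \in alphas -> primitive_vector alpha,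
      C = halfspaces_inter normals &
      forall cs1 c cs2, normals = cs1 ++ c :: cs2 ->
        C <> halfspaces_inter (cs1 ++ cs2)].

Definition ideal_gen (A : comNzRingType) (S : set A) : set A :=
  [set f | exists (r : nat) (c g : 'I_r -> A),
      (forall i, S (g i)) /\ f = \sum_i c i * g i].

(* For k = 0 the only generator is the empty product 1. *)
Definition ideal_power (A : comNzRingType) (I : set A) (k : nat) : set A :=
  ideal_gen [set f | exists2 h : 'I_k -> A,
      (forall j, I (h j)) & f = \prod_j h j].

(* [idealr_closed] includes properness. *)
Definition prime_ideal (A : comNzRingType) (P : set A) : Prop :=
  idealr_closed (mem P) /\ prime_idealr_closed (mem P).

Definition minimal_prime (A : comNzRingType) (I P : set A) : Prop :=
  [/\ prime_ideal P, I `<=` P &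
      forall Q, prime_ideal Q -> I `<=` Q -> Q `<=` P -> Q = P].

Definition symbolic_power (A : comNzRingType) (I : set A) (k : nat) : set A :=
  \bigcap_(P in minimal_prime I) ideal_power P k.

Definition symbolic_rees (A : comNzRingType) (I : set A) : set {poly A} :=
  [set F | forall k, symbolic_power I k F`_k].

Definition edge_ideal (K : fieldType) (m : nat) (H : rel 'I_m) :
    set {mpoly K[m]} :=
  ideal_gen [set f | exists i j, H i j /\ f = 'X_i * 'X_j].

Arguments edge_ideal K [m] H _.

(* The indeterminate t is the 'X of {poly {mpoly K[m]}}. *)
Definition rees_monomial (K : fieldType) (m : nat) (u : 'X_{1..m}) (k : nat) :
    {poly {mpoly K[m]}} :=
  'X_[u] *: 'X^k.

Definition is_rees_monomial (K : fieldType) (m : nat)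
    (F : {poly {mpoly K[m]}}) : Prop :=
  exists u k, F = rees_monomial K u k.

Definition minimal_generator (K : fieldType) (m : nat)
    (S : set {poly {mpoly K[m]}}) (F : {poly {mpoly K[m]}}) : Prop :=
  [/\ is_rees_monomial F, S F, F <> 1 &
      ~ exists F1 F2 : {poly {mpoly K[m]}},
          [/\ is_rees_monomial F1 /\ is_rees_monomial F2, S F1 /\ S F2,
              F1 <> 1 /\ F2 <> 1 & F = F1 * F2]].

(* Main.v *)
Require Import Defs.
From HB Require Import structures.
From mathcomp Require Import all_boot all_order all_algebra.
From mathcomp Require Import boolp classical_sets reals.
From mathcomp Require Import mpoly zify.

Set Implicit Arguments.
Unset Strict Implicit.
Unset Printing Implicit Defensive.

Import Order.TTheory GRing.Theory Num.Theory.
Local Open Scope classical_set_scope.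
Local Open Scope ring_scope.

(* A monomial x^u t^k lies in R_s(I(H)) iff u has weight at least k on every
   vertex cover of H. For the cone H = C(G) the covers to consider are V(G) and
   those consisting of x_{n+1} and a cover of G. If the monomial of the theorem
   is a product of x^u t^k and x^v t^l, then V(G), on which its weight is exactly
   its degree in t, forces u and v to have weights exactly k and l on V(G), and
   the other covers say that (u_1, ..., u_n, u_{n+1} - k) and
   (v_1, ..., v_n, v_{n+1} - l) are nonnegative on the Rees cone. Their sum is
   alpha, which is a primitive vector on an extreme ray of the dual cone, so one
   of the two vanishes, and with it the corresponding monomial is 1. *)

(** * Monomials in symbolic powers of edge ideals *)

Lemma idealr_closedP (A : comNzRingType) (I : set A) :
  idealr_closed (mem I) ->
  [/\ I 0, forall f g, I f -> I g -> I (f + g) & forall a f, I f -> I (a * f)].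
Proof.
move=> [I0 _ ID]; split=> [|f g If Ig|a f If]; apply/set_mem => //.
  by rewrite -[f]mul1r; apply: ID; apply/mem_set.
by rewrite -[_ * _]addr0; apply: ID => //; apply/mem_set.
Qed.

Lemma ideal_gen_sub (A : comNzRingType) (S I : set A) :
  idealr_closed (mem I) -> S `<=` I -> ideal_gen S `<=` I.
Proof.
move=> /idealr_closedP [I0 ID IM] SI _ [r [c [g [Sg ->]]]].
by apply: big_ind => // i _; apply/IM/SI.
Qed.

Lemma ideal_gen_gen (A : comNzRingType) (S : set A) : S `<=` ideal_gen S.
Proof.
move=> f Sf; exists 1%N, (fun=> 1), (fun=> f); split=> //.
by rewrite big_ord1 mul1r.
Qed.

Lemma ideal_power0 (A : comNzRingType) (I : set A) (k : nat) :
  ideal_power I k 0.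
Proof. by exists 0%N, (fun=> 0), (fun=> 0); split=> [[]|]; rewrite ?big_ord0. Qed.

Lemma ideal_powerMl (A : comNzRingType) (I : set A) (k : nat) (a f : A) :
  ideal_power I k f -> ideal_power I k (a * f).
Proof.
move=> [r [c [g [Sg ->]]]]; exists r, (fun i => a * c i), g; split=> //.
by rewrite mulr_sumr; apply: eq_bigr => i _; rewrite mulrA.
Qed.

Lemma ideal_powerS (A : comNzRingType) (I : set A) (k : nat) (a f : A) :
  I a -> ideal_power I k f -> ideal_power I k.+1 (a * f).
Proof.
move=> Ia [r [c [g [Sg ->]]]]; exists r, c, (fun i => a * g i); split=> [i|].
  have [h Ih ->] := Sg i.
  exists (fun j => oapp h a (unlift ord0 j)) => [j|].
    by case: (unlift ord0 j) => /=.
  rewrite big_ord_recl unlift_none /=; congr (_ * _).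
  by apply: eq_bigr => j _; rewrite liftK.
by rewrite mulr_sumr; apply: eq_bigr => i _; rewrite mulrCA.
Qed.

Lemma ideal_powerX (A : comNzRingType) (I : set A) (k e : nat) (a f : A) :
  I a -> ideal_power I k f -> ideal_power I (e + k) (a ^+ e * f).
Proof.
move=> Ia If; elim: e => [|e IHe]; first by rewrite mul1r.
by rewrite exprS -mulrA; apply: ideal_powerS.
Qed.

(** One factor of each generating product is absorbed into its coefficient, and this is repeated
    [l - k] times. *)
Lemma ideal_power_leq (A : comNzRingType) (I : set A) (k l : nat) :
  (k <= l)%N -> ideal_power I l `<=` ideal_power I k.
Proof.
move=> /subnK <-; elim: (l - k)%N => //= e IHe f [r [c [g [Sg ->]]]].
apply: IHe; have /choice [h hP] : forall i, exists h : 'I_(e + k).+1 -> A,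
    (forall j, I (h j)) /\ g i = \prod_j h j.
  by move=> i; have [h Ih gE] := Sg i; exists h.
exists r, (fun i => c i * h i ord0), (fun i => \prod_j h i (lift ord0 j)).
split=> [i|]; first by exists (fun j => h i (lift ord0 j)) => // j; case: (hP i).
by apply: eq_bigr => i _; case: (hP i) => _ ->; rewrite big_ord_recl mulrA.
Qed.

(** Splitting x^u variable by variable, each x_i with i in C adds its exponent to the power, and the
    other variables act as coefficients. *)
Lemma ideal_power_mpolyX (K : fieldType) (m k : nat) (P : set {mpoly K[m]})
    (C : {set 'I_m}) (u : 'X_{1..m}) :
  (forall i, i \in C -> P 'X_i) -> (k <= \sum_(i in C) u i)%N ->
  ideal_power P k 'X_[u].
Proof.
move=> PC le_k; apply: ideal_power_leq le_k _ _; rewrite mpolyXE_id.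
rewrite [X in ideal_power _ X](big_mkcond (fun i => i \in C)).
elim: (index_enum _) => [|i s IHs].
  rewrite !big_nil; exists 1%N, (fun=> 1), (fun=> 1); split=> [_|].
    by exists (fun=> 0); [case|rewrite big_ord0].
  by rewrite big_ord1 mul1r.
rewrite !big_cons; case: ifP => [/PC Pi|_]; last exact: ideal_powerMl.
exact: ideal_powerX.
Qed.

Lemma prime_ideal_ker (A : comNzRingType) (B : idomainType)
    (phi : {rmorphism A -> B}) :
  prime_ideal [set f | phi f = 0].
Proof.
have memE f : (f \in [set f | phi f = 0]) = (phi f == 0).
  by apply/idP/eqP; rewrite in_setE.
split; last by move=> f g; rewrite !memE rmorphM mulf_eq0.
split=> [||a f g]; rewrite !memE ?rmorph0 ?rmorph1 ?oner_eq0 //.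
by rewrite rmorphD rmorphM => /eqP -> /eqP ->; rewrite mulr0 addr0.
Qed.

(** Each of the k factors of a generator has an image without constant term, hence divisible by the
    indeterminate. *)
Lemma dvdX_ideal_power (A B : comNzRingType) (phi : {rmorphism A -> {poly B}})
    (k : nat) (f : A) :
  ideal_power [set f | (phi f)`_0 = 0] k f -> exists g, phi f = 'X ^+ k * g.
Proof.
move=> [r [c [g [Sg ->]]]]; rewrite rmorph_sum /=.
apply: (big_ind (fun p => exists q, p = 'X ^+ k * q)) => [|p q|i _].
- by exists 0; rewrite mulr0.
- by move=> [p' ->] [q' ->]; exists (p' + q'); rewrite mulrDr.
have [h Ph ->] := Sg i; rewrite rmorphM rmorph_prod /=.
have /choice [q hE] : forall j, exists q, phi (h j) = 'X * q.
  move=> j; exists (\poly_(i < size (phi (h j))) (phi (h j))`_i.+1).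
  apply/polyP => -[|l]; rewrite mulrC coefMX /= ?(Ph j) //.
  by rewrite coef_poly; case: ltnP => // /leqW /leq_sizeP ->.
exists (phi (c i) * \prod_j q j).
rewrite (eq_bigr (fun j => 'X * q j)) // big_split /= prodr_const card_ord.
by rewrite mulrCA.
Qed.

Section CoverIdeal.

Variables (K : fieldType) (m : nat) (C : {set 'I_m}).

(* The grading by total degree in the variables of C: each x_i with i in C is
   replaced by x_i T, so that the prime (x_i : i in C) consists of the f whose
   image vanishes at T = 0, and its k-th power is sent into (T^k). *)
Definition grading_var (i : 'I_m) : {poly {mpoly K[m]}} :=
  ('X_i)%:P * 'X ^+ (i \in C).

Definition grading : {mpoly K[m]} -> {poly {mpoly K[m]}} :=
  mmap (polyC \o @mpolyC m K) grading_var.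

HB.instance Definition _ := GRing.RMorphism.on grading.

Definition cover_prime : set {mpoly K[m]} := [set f | (grading f)`_0 = 0].

Lemma grading_mpolyX (u : 'X_{1..m}) :
  grading 'X_[u] = ('X_[u])%:P * 'X ^+ (\sum_(i in C) u i).
Proof.
rewrite /grading mmapX /mmap1 /grading_var [in RHS]mpolyXE_id rmorph_prod /=.
rewrite (eq_bigr (fun i => ('X_i ^+ u i)%:P * 'X ^+ ((i \in C) * u i))).
  rewrite big_split /= -expr_sum; congr (_ * 'X^ _).
  by rewrite [RHS]big_mkcond; apply: eq_bigr => i _; case: (i \in C); rewrite ?mul1n.
by move=> i _; rewrite exprMn -exprM rmorphXn.
Qed.

Lemma cover_prime_var (i : 'I_m) : cover_prime 'X_i <-> i \in C.
Proof.
rewrite /cover_prime /= /grading mmapX mmap1U /grading_var coefCM coefXn.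
case: (i \in C); rewrite ?mulr0 ?mulr1 //; split=> // /eqP.
by rewrite -msupp_eq0 msuppX.
Qed.

Lemma cover_prime_prime : prime_ideal cover_prime.
Proof. exact: (prime_ideal_ker (coefp 0 \o grading)). Qed.

(** The grading sends x^u to x^u T^e, with e its degree in the variables of C; divisibility by T^k
    forces k <= e. *)
Lemma cover_prime_power_mpolyX (k : nat) (u : 'X_{1..m}) :
  ideal_power cover_prime k 'X_[u] -> (k <= \sum_(i in C) u i)%N.
Proof.
move=> Iu; have [g] : exists g, grading 'X_[u] = 'X ^+ k * g.
  exact: dvdX_ideal_power Iu.
rewrite grading_mpolyX => E.
have := congr1 (fun p : {poly _} => p`_(\sum_(i in C) u i)) E.
rewrite coefCM coefXn eqxx mulr1 coefXnM; case: ltnP => // _ /eqP.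
by rewrite -msupp_eq0 msuppX.
Qed.

(** Subtracting from f the constant coefficient of its image leaves only monomials divisible by a
    variable of C, and on [cover_prime] this coefficient is 0. *)
Lemma cover_prime_sub (Q : set {mpoly K[m]}) :
  prime_ideal Q -> (forall i, i \in C -> Q 'X_i) -> cover_prime `<=` Q.
Proof.
move=> [/idealr_closedP [Q0 QD QM] _] QC.
suff Qsub f : Q (f - (grading f)`_0).
  by move=> f /= f0; have := Qsub f; rewrite f0 subr0.
pose d := fun f => f - (grading f)`_0.
(* The map [d] is linear, which reduces the claim to monomials. *)
have dE : d f = \sum_(v <- msupp f) f@_v *: d 'X_[v].
  rewrite {1}[f]mpolyE /d rmorph_sum coef_sum -sumrB.
  apply: eq_bigr => v _; rewrite -[_ *: _ in X in _ - X]mul_mpolyC rmorphM /=.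
  rewrite /grading mmapC /= coefCM -mul_mpolyC -[_ *: _]mul_mpolyC.
  by rewrite mulrBr.
rewrite -/(d f) dE.
apply: big_ind => // v _.
rewrite -mul_mpolyC; apply: (QM); rewrite /d grading_mpolyX coefCM coefXn.
case: eqP => [_|ne0]; first by rewrite mulr1 subrr.
rewrite mulr0 subr0.
have [i Ci vi] : exists2 i, i \in C & v i != 0%N.
  apply/exists_inP; apply: contra_notT ne0; rewrite negb_exists_in.
  move=> /forall_inP v0; symmetry; apply: big1 => i /v0.
  by rewrite negbK => /eqP.
rewrite mpolyXE_id (bigD1 i) //= -(prednK (n := v i)) ?lt0n // exprSr.
by rewrite mulrAC; apply/QM/QC.
Qed.

End CoverIdeal.

Arguments cover_prime K [m] C _.

Lemma prime_vertex_cover (K : fieldType) (m : nat) (H : rel 'I_m)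
    (P : set {mpoly K[m]}) :
  prime_ideal P -> edge_ideal K H `<=` P ->
  vertex_cover H [set i | 'X_i \in P]%SET.
Proof.
move=> [_ Pprime] IP; apply/forallP => i; apply/forallP => j.
apply/implyP => Hij; rewrite !inE; apply: Pprime; apply/mem_set/IP.
by apply: ideal_gen_gen; exists i, j.
Qed.

(** The variables in a prime Q between the edge ideal and [cover_prime K C] form a cover inside C,
    so by minimality Q contains all variables of C. *)
Lemma cover_prime_minimal (K : fieldType) (m : nat) (H : rel 'I_m)
    (C : {set 'I_m}) :
  minset (vertex_cover H) C -> minimal_prime (edge_ideal K H) (cover_prime K C).
Proof.
move=> /minsetP [/forallP covC minC]; split; first exact: cover_prime_prime.
  apply: ideal_gen_sub; first by case: (@cover_prime_prime K m C).
  move=> _ [i [j [Hij ->]]].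
  have [/idealr_closedP [_ _ IM] _] := @cover_prime_prime K m C.
  have /forallP/(_ j)/implyP/(_ Hij)/orP[] := covC i => /(cover_prime_var K) Ix.
    by rewrite mulrC; apply: IM.
  exact: IM.
move=> Q Qprime IQ QP; apply/seteqP; split=> //.
apply: cover_prime_sub => // i Ci.
have : [set i | 'X_i \in Q]%SET = C.
  apply: minC; first exact: prime_vertex_cover.
  by apply/fintype.subsetP => j; rewrite inE in_setE => /QP /cover_prime_var.
by move/setP/(_ i); rewrite Ci !inE => /set_mem.
Qed.

(** Forward, every cover contains a minimal one, whose cover prime is a minimal prime. Backward, the
    variables in a given minimal prime form a cover, and the weight of u on it is large enough. *)
Lemma symbolic_power_mpolyX (K : fieldType) (m : nat) (H : rel 'I_m) (k : nat)
    (u : 'X_{1..m}) :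
  symbolic_power (edge_ideal K H) k 'X_[u] <->
  (forall C, vertex_cover H C -> (k <= \sum_(i in C) u i)%N).
Proof.
split=> [Iu C covC|le_k P [Pprime IP _]].
  have [D minD DC] := minset_exists covC.
  have /cover_prime_power_mpolyX le_k := Iu _ (cover_prime_minimal K minD).
  apply: leq_trans le_k _; rewrite [leqLHS]big_mkcond [leqRHS]big_mkcond /=.
  apply: leq_sum => i _; case: ifP => // iD.
  by rewrite (fintype.subsetP DC).
apply: (ideal_power_mpolyX (C := [set i | 'X_i \in P]%SET)).
  by move=> i; rewrite inE in_setE.
exact/le_k/prime_vertex_cover.
Qed.

(** * Monomials of the symbolic Rees algebra *)

Lemma coef_rees_monomial (K : fieldType) (m : nat) (u : 'X_{1..m}) (k l : nat) :
  (rees_monomial K u k)`_l = if l == k then 'X_[u] else 0.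
Proof. by rewrite coefZ coefXn; case: eqP; rewrite ?mulr1 ?mulr0. Qed.

Lemma symbolic_rees_monomial (K : fieldType) (m : nat) (H : rel 'I_m)
    (u : 'X_{1..m}) (k : nat) :
  symbolic_rees (edge_ideal K H) (rees_monomial K u k) <->
  (forall C, vertex_cover H C -> (k <= \sum_(i in C) u i)%N).
Proof.
rewrite -symbolic_power_mpolyX; split=> [/(_ k)|Iu l].
  rewrite coef_rees_monomial eqxx; exact.
rewrite coef_rees_monomial; case: eqP => [->|_ P _] //.
exact: ideal_power0.
Qed.

Lemma rees_monomial_inj (K : fieldType) (m : nat) (u v : 'X_{1..m}) (k l : nat) :
  rees_monomial K u k = rees_monomial K v l -> u = v /\ k = l.
Proof.
move=> E; have := congr1 (fun p : {poly _} => (p`_k)@_u) E.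
rewrite !coef_rees_monomial eqxx mcoeffX eqxx.
case: (k =P l) => [->|_]; last by rewrite mcoeff0 => /eqP; rewrite oner_eq0.
rewrite mcoeffX; case: (v =P u) => // _ /eqP.
by rewrite oner_eq0.
Qed.

Lemma rees_monomialM (K : fieldType) (m : nat) (u v : 'X_{1..m}) (k l : nat) :
  rees_monomial K u k * rees_monomial K v l = rees_monomial K (u + v)%MM (k + l).
Proof. by rewrite /rees_monomial -scalerAl -scalerAr scalerA mpolyXD exprD. Qed.

Lemma rees_monomial0 (K : fieldType) (m : nat) : rees_monomial K (0%MM : 'X_{1..m}) 0 = 1.
Proof. by rewrite /rees_monomial mpolyX0 scale1r. Qed.

(** * Facet normals *)

Definition dot (A : pzRingType) (m : nat) (y c : 'rV[A]_m) : A :=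
  \sum_j y 0 j * c 0 j.

Lemma dotDl (A : pzRingType) (m : nat) (y z c : 'rV[A]_m) :
  dot (y + z) c = dot y c + dot z c.
Proof. by rewrite -big_split; apply: eq_bigr => j _; rewrite mxE mulrDl. Qed.

Lemma dotZl (A : pzRingType) (m : nat) (x : A) (y c : 'rV[A]_m) :
  dot (x *: y) c = x * dot y c.
Proof. by rewrite [RHS]mulr_sumr; apply: eq_bigr => j _; rewrite mxE mulrA. Qed.

Lemma dotDr (A : pzRingType) (m : nat) (y c d : 'rV[A]_m) :
  dot y (c + d) = dot y c + dot y d.
Proof. by rewrite -big_split; apply: eq_bigr => j _; rewrite mxE mulrDr. Qed.

Lemma dotZr (A : comPzRingType) (m : nat) (x : A) (y c : 'rV[A]_m) :
  dot y (x *: c) = x * dot y c.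
Proof. by rewrite [RHS]mulr_sumr; apply: eq_bigr => j _; rewrite mxE mulrCA. Qed.

Lemma dot_delta (A : pzRingType) (m : nat) (j : 'I_m) (c : 'rV[A]_m) :
  dot (delta_mx 0 j) c = c 0 j.
Proof.
rewrite /dot (bigD1 j) //= big1 ?addr0 => [|i /negPf ij].
  by rewrite mxE !eqxx mul1r.
by rewrite mxE ij mul0r.
Qed.

Lemma dot_suml (A : pzRingType) (m : nat) (I : Type) (r : seq I) (P : pred I)
    (F : I -> 'rV[A]_m) (c : 'rV[A]_m) :
  dot (\sum_(i <- r | P i) F i) c = \sum_(i <- r | P i) dot (F i) c.
Proof.
rewrite exchange_big; apply: eq_bigr => j _.
by rewrite summxE mulr_suml.
Qed.

Lemma halfspaces_interP (R : realType) (m : nat) (cs : seq 'rV[R]_m)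
    (y : 'rV[R]_m) :
  halfspaces_inter cs y <-> (forall c, c \in cs -> 0 <= dot y c).
Proof. by split=> h c; [move=> /h|move=> /= /h]. Qed.

(** Allows moving from [w] by [e] along [v], in both directions, without leaving any of the
    halfspaces. *)
Lemma small_step (R : realType) (m : nat) (cs : seq 'rV[R]_m) (w v : 'rV[R]_m) :
  (forall c, c \in cs -> 0 < dot w c) ->
  exists2 e, 0 < e & forall c, c \in cs -> e * `|dot v c| <= dot w c.
Proof.
elim: cs => [|c cs IHcs] w_gt0; first by exists 1.
have [c' c'cs|e e_gt0 eP] := IHcs; first by apply: w_gt0; rewrite inE c'cs orbT.
have wc_gt0 : 0 < dot w c by apply: w_gt0; rewrite mem_head.
have n_gt0 : 0 < 1 + `|dot v c| by rewrite ltr_pwDl.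
(* The summand 1 keeps the denominator positive when [dot v c] is 0. *)
exists (Num.min e (dot w c / (1 + `|dot v c|))).
  by rewrite lt_min e_gt0 divr_gt0.
move=> c'; rewrite inE => /predU1P[->|c'cs].
  apply: le_trans (_ : dot w c / (1 + `|dot v c|) * (1 + `|dot v c|) <= _).
    apply: ler_pM; rewrite ?ge_min ?lexx ?orbT ?lerDr //.
    by rewrite le_min !ltW // divr_gt0.
  by rewrite divfK // gt_eqF.
by apply: le_trans (eP _ c'cs); rewrite ler_wpM2r // ge_min lexx.
Qed.

(* An omitted halfspace leaves a point y outside C; where the segment from the
   interior point z to y crosses the hyperplane of c, all other inequalities are
   strict, so g vanishes on a neighbourhood of that point in the hyperplane. *)
Lemma irredundant_normal_colinear (R : realType) (m : nat) (C : set 'rV[R]_m)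
    (cs1 cs2 : seq 'rV[R]_m) (c g d z : 'rV[R]_m) :
  C = halfspaces_inter (cs1 ++ c :: cs2) ->
  C <> halfspaces_inter (cs1 ++ cs2) ->
  (forall c', c' \in cs1 ++ c :: cs2 -> 0 < dot z c') ->
  c = g + d ->
  (forall y, C y -> 0 <= dot y g) -> (forall y, C y -> 0 <= dot y d) ->
  forall j k, g 0 j * c 0 k = g 0 k * c 0 j.
Proof.
move=> CE Cne z_gt0 cE g_ge0 d_ge0 j k.
have inC y : 0 <= dot y c -> (forall c', c' \in cs1 ++ cs2 -> 0 <= dot y c') -> C y.
  move=> yc ycs; rewrite CE; apply/halfspaces_interP => c'.
  rewrite mem_cat inE orbCA => /predU1P[->//|c'P].
  by apply: ycs; rewrite mem_cat.
have zc_gt0 : 0 < dot z c by apply: z_gt0; rewrite mem_cat mem_head orbT.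
have [y yP yc_lt0] : exists2 y, halfspaces_inter (cs1 ++ cs2) y & dot y c < 0.
  apply: contrapT => noy; apply: Cne; apply/seteqP; split=> [y|y yP].
    rewrite CE => /halfspaces_interP yP; apply/halfspaces_interP => c' c'P.
    by apply: yP; move: c'P; rewrite !mem_cat inE => /orP[->|->]; rewrite ?orbT.
  apply: inC; last by apply/halfspaces_interP.
  by rewrite leNgt; apply/negP => yc; apply: noy; exists y.
pose w := dot z c *: y + (- dot y c) *: z.
have wc : dot w c = 0 by rewrite dotDl !dotZl mulNr mulrC subrr.
have w_gt0 c' : c' \in cs1 ++ cs2 -> 0 < dot w c'.
  move=> c'P; rewrite dotDl !dotZl ltr_wpDl //.
    by rewrite mulr_ge0 ?(ltW zc_gt0) //; move/halfspaces_interP: yP; apply.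
  rewrite mulr_gt0 ?oppr_gt0 //; apply: z_gt0.
  by move: c'P; rewrite !mem_cat inE => /orP[->|->]; rewrite ?orbT.
(* This [v] is orthogonal to [c], and [dot v g] is the 2 x 2 minor that has to vanish. *)
pose v := c 0 k *: delta_mx 0 j + (- c 0 j) *: delta_mx 0 k : 'rV[R]_m.
have vc : dot v c = 0 by rewrite dotDl !dotZl !dot_delta mulNr mulrC subrr.
have [e e_gt0 eP] := small_step v w_gt0.
(* On the hyperplane of [c] the nonnegative values of [g] and [d] add up to 0, so that of [g] is 0.
   Taking [s] to be [e] and [- e] isolates [dot v g]. *)
have g0 s : `|s| = e -> dot w g + s * dot v g = 0.
  move=> sE; rewrite -dotZl -dotDl.
  have ws_c : dot (w + s *: v) c = 0 by rewrite dotDl dotZl wc vc mulr0 addr0.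
  have wsC : C (w + s *: v).
    apply: inC; first by rewrite ws_c.
    move=> c' c'P; rewrite dotDl dotZl -lerBlDr sub0r.
    by apply: le_trans (eP _ c'P); rewrite -sE -normrM -normrN ler_norm.
  apply/eqP; rewrite eq_le g_ge0 // andbT.
  by rewrite -ws_c cE dotDr lerDl d_ge0.
have /eqP : 2 * e * dot v g = 0.
  have e1 := g0 e (gtr0_norm e_gt0).
  have e2 : dot w g - e * dot v g = 0 by rewrite -mulNr g0 // normrN gtr0_norm.
  rewrite -mulrA mulr_natl mulr2n -[X in X + _](addKr (dot w g)) e1 addr0 addrC.
  by rewrite -opprB e2 oppr0.
rewrite mulf_eq0 mulf_eq0 pnatr_eq0 (gt_eqF e_gt0) /= dotDl !dotZl !dot_delta.
by rewrite mulNr subr_eq0 mulrC [X in _ == X]mulrC => /eqP.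
Qed.

Lemma primitive_vector_neq0 (m : nat) (al : 'rV[int]_m) :
  primitive_vector al -> al != 0.
Proof.
move=> prim; apply/eqP => al0; move: prim; rewrite /primitive_vector al0.
by rewrite big1 // => j _; rewrite mxE.
Qed.

Lemma primitive_vector_colinear (m : nat) (al g : 'rV[int]_m) :
  primitive_vector al ->
  (forall j k, g 0 j * al 0 k = g 0 k * al 0 j) -> exists x, g = x *: al.
Proof.
move=> prim par.
have [k al_k0] : exists k, al 0 k != 0.
  apply: contrapT => al0; have /eqP := primitive_vector_neq0 prim; apply.
  apply/rowP => k; rewrite mxE; apply/eqP; apply: contra_notT al0.
  by exists k.
(* The entry al_k divides every g_k al_j = g_j al_k, hence also their gcd over j, which is g_k up to
   sign because the al_j have gcd 1. *)
have al_g : dvdn (absz (al 0 k)) (absz (g 0 k)).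
  rewrite -[absz (g 0 k)]muln1 -[X in (_ * X)%N]prim.
  rewrite (big_morph (muln _) (muln_gcdr _) (muln0 _)).
  by apply/dvdn_biggcdP => j _; rewrite -abszM -par abszM dvdn_mull.
have /dvdzP [y yE] : g 0 k \in dvdz (al 0 k) by [].
exists y; apply/rowP => j; rewrite mxE; apply: (mulIf al_k0).
by rewrite par yE mulrAC.
Qed.

Lemma map_mx_intr_eq0 (R : realType) (m : nat) (c : 'rV[int]_m) :
  (map_mx intr c == 0 :> 'rV[R]_m) = (c == 0).
Proof.
apply/eqP/eqP => [c0|->]; last exact: raddf0.
apply/rowP => j; have /rowP/(_ j)/eqP := c0.
by rewrite !mxE intr_eq0 => /eqP.
Qed.

(** Irredundancy makes [g] and [d] multiples of [al], and primitivity makes the factors integers x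
    and 1 - x. The point [z], which acts as an interior point of C, shows that both are nonnegative,
    so x is 0 or 1. *)
Lemma irreducible_representation_indecomposable (R : realType) (m : nat)
    (C : set 'rV[R]_m) (alphas : seq 'rV[int]_m) (z : 'rV[R]_m)
    (al g d : 'rV[int]_m) :
  irreducible_representation C alphas ->
  (forall c, c != 0 -> (forall y, C y -> 0 <= dot y c) -> 0 < dot z c) ->
  al \in alphas -> al = g + d ->
  (forall y, C y -> 0 <= dot y (map_mx intr g)) ->
  (forall y, C y -> 0 <= dot y (map_mx intr d)) ->
  g = 0 \/ d = 0.
Proof.
move=> [prim CE irr] zP al_in alE gP dP.
have al_n0 := primitive_vector_neq0 (prim _ al_in).
set normals := _ ++ _ in CE irr.
have z_gt0 c : c \in normals -> 0 < dot z c.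
  move=> c_in; apply: zP; last first.
    by move=> y; rewrite CE => /halfspaces_interP; apply.
  move: c_in; rewrite mem_cat => /orP[] /mapP [].
    move=> j _ ->; apply/eqP => /rowP/(_ j)/eqP.
    by rewrite !mxE !eqxx oner_eq0.
  by move=> al' /prim /primitive_vector_neq0 al'_n0 ->; rewrite map_mx_intr_eq0.
have [cs1 [cs2 nE]] : exists cs1 cs2, normals = cs1 ++ map_mx intr al :: cs2.
  have : map_mx intr al \in normals by rewrite mem_cat map_f ?orbT.
  by case/path.splitPr => cs1 cs2; exists cs1, cs2.
rewrite nE in CE z_gt0.
have alE' : map_mx intr al = map_mx intr g + map_mx intr d :> 'rV[R]_m.
  by rewrite alE; exact: raddfD.
have par := irredundant_normal_colinear CE (irr _ _ _ nE) z_gt0 alE' gP dP.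
have [x gE] : exists x, g = x *: al.
  apply: primitive_vector_colinear (prim _ al_in) _ => j k.
  by apply/eqP; have /eqP := par j k; rewrite !mxE -!intrM eqr_int.
have dE : d = (1 - x) *: al by rewrite scalerBl scale1r -gE alE addrAC subrr add0r.
have zal : 0 < dot z (map_mx intr al) by apply: z_gt0; rewrite mem_cat mem_head orbT.
have coef_ge0 (s : int) :
    (forall y, C y -> 0 <= dot y (map_mx intr (s *: al))) -> 0 <= s.
  move=> sP; have : 0 <= dot z (map_mx intr (s *: al)).
    (* The positivity of [z] is available on nonzero vectors only, so a zero multiple is treated
       apart. *)
    have [->|sal_n0] := eqVneq (s *: al) 0.
      by rewrite /dot big1 // => j _; rewrite !mxE mulr0.
    by apply/ltW/zP; rewrite ?map_mx_intr_eq0.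
  have -> : map_mx intr (s *: al) = s%:~R *: map_mx intr al :> 'rV[R]_m.
    by apply/rowP => j; rewrite !mxE intrM.
  by rewrite dotZr pmulr_lge0 // ler0z.
have x_ge0 : 0 <= x by apply: coef_ge0; rewrite -gE.
have : 0 <= 1 - x by apply: coef_ge0; rewrite -dE.
rewrite subr_ge0 => x_le1.
have : (x == 0) || (x == 1) by lia.
case/orP => /eqP xE; [left|right]; first by rewrite gE xE scale0r.
by rewrite dE xE subrr scale0r.
Qed.

(** * Vertex covers and the Rees cone *)

Lemma extend_lift (T : Type) (n : nat) (v : 'I_n -> T) (x : T) (i : 'I_n) :
  extend v x (lift ord_max i) = v i.
Proof. by rewrite /extend liftK. Qed.

Lemma extend_max (T : Type) (n : nat) (v : 'I_n -> T) (x : T) :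
  extend v x ord_max = x.
Proof. by rewrite /extend unlift_none. Qed.

Lemma eq_on_lift_max (T : Type) (n : nat) (f g : 'I_n.+1 -> T) :
  (forall i, f (lift ord_max i) = g (lift ord_max i)) ->
  f ord_max = g ord_max -> f =1 g.
Proof. by move=> fg_lift fg_max j; case: (unliftP ord_max j) => [i|] ->. Qed.

Lemma dot_ord_max (A : pzRingType) (n : nat) (y c : 'rV[A]_n.+1) :
  dot y c = \sum_i y 0 (lift ord_max i) * c 0 (lift ord_max i)
            + y 0 ord_max * c 0 ord_max.
Proof. by rewrite /dot (bigD1_ord ord_max) //= addrC. Qed.

Section CoverCone.

Variables (R : realType) (n : nat) (G : rel 'I_n).

Definition cover_vector (C : {set 'I_n}) : 'rV[R]_n.+1 :=
  \row_j extend (fun i => (i \in C)%:R) 1 j.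

Lemma dot_cover_vector (C : {set 'I_n}) (c : 'rV[R]_n.+1) :
  dot (cover_vector C) c = \sum_(i in C) c 0 (lift ord_max i) + c 0 ord_max.
Proof.
rewrite dot_ord_max mxE extend_max mul1r [in RHS]big_mkcond; congr (_ + _).
apply: eq_bigr => i _; rewrite mxE extend_lift.
by case: (i \in C); rewrite ?mul1r ?mul0r.
Qed.

(** Ensures that a coefficient function supported at a single u selects that generator exactly
    once. *)
Lemma uniq_min_cover_vectors : uniq (min_cover_vectors G).
Proof.
rewrite map_inj_uniq ?enum_uniq // => C D /mnmP CD; apply/setP => i.
by have := CD i; rewrite !mnmE; case: (i \in C); case: (i \in D).
Qed.

(** Nonnegativity has to be checked on generators only; each generator is in the cone by means of
    indicator coefficients. *)
Lemma cover_rees_cone_ge0 (c : 'rV[R]_n.+1) :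
  (forall y, cover_rees_cone R G y -> 0 <= dot y c) <->
  (forall i, 0 <= c 0 (lift ord_max i)) /\
  (forall C, minset (vertex_cover G) C -> 0 <= dot (cover_vector C) c).
Proof.
have vecE (C : {set 'I_n}) :
    \row_j extend (fun i => ([multinom (i \in C : nat) | i < n] i)%:R) 1 j
    = cover_vector C.
  by apply/rowP; apply: eq_on_lift_max => [i|];
    rewrite !mxE ?extend_lift ?extend_max ?mnmE.
split=> [c_ge0|[c_ge0 cC_ge0] _ [x [d [x_ge0 d_ge0 ->]]]]; last first.
  rewrite dotDl !dot_suml addr_ge0 //.
    by apply: sumr_ge0 => i _; rewrite dotZl dot_delta mulr_ge0.
  rewrite /min_cover_vectors big_map big_seq sumr_ge0 // => C.
  rewrite mem_enum inE => minC.
  by rewrite dotZl vecE mulr_ge0 // cC_ge0.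
split=> [i|C minC].
  rewrite -dot_delta; apply: c_ge0.
  exists (fun k => (k == i)%:R), (fun=> 0); split=> //.
  rewrite [X in _ + X]big1 ?addr0 => [|u _]; last by rewrite scale0r.
  rewrite (bigD1 i) //= eqxx scale1r big1 ?addr0 // => k /negPf ->.
  by rewrite scale0r.
apply: c_ge0; pose u := [multinom (i \in C : nat) | i < n].
exists (fun=> 0), (fun v => (v == u)%:R); split=> //.
rewrite big1 ?add0r => [|i _]; last by rewrite scale0r.
rewrite (bigD1_seq u) ?uniq_min_cover_vectors //=; last first.
  by apply: map_f; rewrite mem_enum.
rewrite eqxx scale1r vecE big1 ?addr0 // => v /negPf ->.
by rewrite scale0r.
Qed.

Lemma vertex_coverT : vertex_cover G [set: 'I_n]%SET.
Proof. by apply/forallP => i; apply/forallP => j; rewrite !inE implybT. Qed.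

(** The point is the sum of e_1, ..., e_n and one generator (u, 1). A vector of the dual cone
    orthogonal to it is orthogonal to every summand: the e_i make its first n entries vanish, then
    (u, 1) the last. *)
Lemma cover_rees_cone_interior :
  exists z : 'rV[R]_n.+1, forall c, c != 0 ->
    (forall y, cover_rees_cone R G y -> 0 <= dot y c) -> 0 < dot z c.
Proof.
have [C minC _] := minset_exists vertex_coverT.
exists (\sum_i delta_mx 0 (lift ord_max i) + cover_vector C) => c c_n0.
move=> /cover_rees_cone_ge0 [c_ge0 /(_ C minC) cC_ge0].
have s_ge0 : 0 <= \sum_i c 0 (lift ord_max i) by apply: sumr_ge0.
rewrite dotDl dot_suml (eq_bigr _ (fun i _ => dot_delta _ _)).
rewrite lt0r addr_ge0 // andbT; apply: contra_neq c_n0 => /eqP.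
rewrite paddr_eq0 // psumr_eq0 // => /andP[/allP c0 /eqP].
have {}c0 i : c 0 (lift ord_max i) = 0 by apply/eqP/c0; rewrite mem_index_enum.
rewrite dot_cover_vector big1 // add0r => cmax.
by apply/rowP; apply: eq_on_lift_max => [i|]; rewrite mxE.
Qed.

(** As [p] has natural values, its sum over a cover is at least its sum over a minimal cover inside,
    so the inequalities extend from minimal covers to all covers. *)
Lemma cover_rees_cone_dual (p : 'I_n -> nat) (q : int) :
  (forall y, cover_rees_cone R G y ->
     0 <= dot y (map_mx intr (\row_j extend (fun i => (p i)%:Z) q j))) <->
  (forall C, vertex_cover G C -> 0 <= (\sum_(i in C) p i)%N%:Z + q).
Proof.
set c := \row_j _.
have dotE C : dot (cover_vector C) (map_mx intr c)
              = ((\sum_(i in C) p i)%N%:Z + q)%:~R.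
  rewrite dot_cover_vector !mxE extend_max intrD; congr (_ + _).
  rewrite -pmulrn natr_sum; apply: eq_bigr => i _.
  by rewrite !mxE extend_lift -pmulrn.
rewrite cover_rees_cone_ge0; split=> [[_ c_ge0] C covC|c_ge0].
  have [D minD DC] := minset_exists covC.
  apply: le_trans (_ : (\sum_(i in D) p i)%N%:Z + q <= _).
    by have := c_ge0 D minD; rewrite dotE ler0z.
  rewrite lerD2r lez_nat [leqLHS]big_mkcond [leqRHS]big_mkcond /=.
  by apply: leq_sum => i _; case: ifP => // /(fintype.subsetP DC) ->.
split=> [i|C /minsetP[covC _]]; first by rewrite !mxE extend_lift ler0z.
by rewrite dotE ler0z c_ge0.
Qed.

End CoverCone.

(** * Symbolic Rees algebras of cones over graphs *)

(** The edges at the new vertex are covered either by that vertex or by all of their other ends, and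
    in the latter case every edge of G is covered too. *)
Lemma vertex_cover_cone (n : nat) (G : rel 'I_n) (D : {set 'I_n.+1}) :
  vertex_cover (cone_graph G) D =
  (ord_max \in D) && vertex_cover G [set i | lift ord_max i \in D]%SET
  || [forall i, lift ord_max i \in D].
Proof.
apply/idP/idP => [covD|].
  have covDP i j : cone_graph G i j -> (i \in D) || (j \in D).
    by move: covD => /forallP/(_ i)/forallP/(_ j)/implyP; apply.
  case: (boolP (ord_max \in D)) => maxD /=.
    apply/orP; left; apply/forallP => i; apply/forallP => j; apply/implyP => Gij.
    by rewrite !inE; apply: covDP; rewrite /cone_graph !liftK.
  apply/forallP => i; have := covDP (lift ord_max i) ord_max.
  by rewrite (negPf maxD) orbF; apply; rewrite /cone_graph liftK unlift_none.
move=> covD; apply/forallP => i; apply/forallP => j; apply/implyP.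
case/orP: covD => [/andP[maxD covD]|/forallP inD]; last first.
  rewrite /cone_graph.
  case: (unliftP ord_max i) => [i'|] ->; first by rewrite inD.
  by case: (unliftP ord_max j) => [j'|] ->; rewrite ?inD ?orbT.
rewrite /cone_graph; case: (unliftP ord_max i) => [i'|] ->; last by rewrite maxD.
case: (unliftP ord_max j) => [j'|] -> Gij; last by rewrite maxD orbT.
by move: covD => /forallP/(_ i')/forallP/(_ j')/implyP/(_ Gij); rewrite !inE.
Qed.

(** Exponents are nonnegative, so it suffices to test V(G) and the sets formed by the new vertex and
    a cover of G. *)
Lemma symbolic_rees_cone (K : fieldType) (n : nat) (G : rel 'I_n)
    (u : 'X_{1..n.+1}) (k : nat) :
  symbolic_rees (edge_ideal K (cone_graph G)) (rees_monomial K u k) <->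
  (k <= \sum_i u (lift ord_max i))%N /\
  (forall C, vertex_cover G C ->
     (k <= u ord_max + \sum_(i in C) u (lift ord_max i))%N).
Proof.
have sumE (D : {set 'I_n.+1}) : (\sum_(j in D) u j)%N =
    ((ord_max \in D) * u ord_max
     + \sum_(i | lift ord_max i \in D) u (lift ord_max i))%N.
  rewrite big_mkcond (bigD1_ord ord_max) //= -big_mkcond /=.
  by case: (_ \in D); rewrite ?mul1n.
rewrite symbolic_rees_monomial; split=> [le_k|[le_kT le_k] D].
  split=> [|C covC].
    apply: leq_trans (le_k [set~ ord_max]%SET _) _.
      rewrite vertex_cover_cone; apply/orP; right; apply/forallP => i.
      by rewrite !inE eq_sym neq_lift.
    rewrite sumE !inE eqxx mul0n add0n [leqLHS]big_mkcond.
    by apply: leq_sum => i _; case: ifP.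
  pose D : {set 'I_n.+1} := [set j | extend (fun i => i \in C) true j]%SET.
  have liftD i : (lift ord_max i \in D) = (i \in C) by rewrite inE extend_lift.
  have maxD : ord_max \in D by rewrite inE extend_max.
  apply: leq_trans (le_k D _) _.
    rewrite vertex_cover_cone maxD; apply/orP; left.
    suff -> : [set i | lift ord_max i \in D]%SET = C by [].
    by apply/setP => i; rewrite inE liftD.
  by rewrite sumE maxD mul1n (eq_bigl _ _ liftD).
rewrite vertex_cover_cone sumE => /orP[/andP[-> /le_k]|/forallP inD].
  by rewrite mul1n; under eq_bigl do rewrite inE.
by apply: leq_trans le_kT _; rewrite (eq_bigl _ _ inD) leq_addl.
Qed.

(* The conjunct on b says that beta_{n+1} = (\sum_i a i) - b is a natural
   number, so that the subtraction on nat below is not truncated. *)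
Theorem corollary3p24 (R : realType) (K : fieldType) (n : nat) (G : rel 'I_n)
    (symG : ssrbool.symmetric G) (irrG : irreflexive G)
    (alphas : seq 'rV[int]_n.+1)
    (irred : irreducible_representation (cover_rees_cone R G) alphas)
    (a : 'I_n -> nat) (b : nat)
    (alpha_in : (\row_j extend (fun i => (a i)%:Z) (- b%:Z) j) \in alphas)
    (a_ge1 : forall i, (1 <= a i)%N) :
  (b <= \sum_i a i)%N /\
  minimal_generator (symbolic_rees (edge_ideal K (cone_graph G)))
    (rees_monomial K
       [multinom extend a ((\sum_i a i) - b)%N j | j < n.+1]
       (\sum_i a i)%N).
Proof.
set al := \row_j _ in alpha_in.
have [prim coneE _] := irred.
have al_ge0 y : cover_rees_cone R G y -> 0 <= dot y (map_mx intr al).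
  rewrite coneE => /halfspaces_interP; apply.
  by rewrite mem_cat (map_f (map_mx intr)) ?orbT.
have le_b C : vertex_cover G C -> (b <= \sum_(i in C) a i)%N.
  move=> covC; have /cover_rees_cone_dual/(_ C covC) := al_ge0.
  by rewrite subr_ge0 lez_nat.
have le_bT : (b <= \sum_i a i)%N.
  have := le_b _ (vertex_coverT G).
  by under eq_bigl do rewrite inE.
split=> //; set beta := [multinom _ | j < _].
have betaE i : beta (lift ord_max i) = a i by rewrite mnmE extend_lift.
have beta_max : beta ord_max = (\sum_i a i - b)%N by rewrite mnmE extend_max.
split; first by exists beta, (\sum_i a i)%N.
- apply/symbolic_rees_cone; split=> [|C covC].
    by apply: leq_sum => i _; rewrite betaE.
  (* On the new vertex and C the weight is (sum of all a_i) - b plus the sum of the a_i over C, and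
     the latter sum is at least b. *)
  under [X in (_ <= _ + X)%N]eq_bigr do rewrite betaE.
  rewrite beta_max -leq_subLR subKn //.
  exact: le_b.
(* If the monomial were 1, the sum of the a_i would be 0, hence also b, and [al] would vanish. *)
- rewrite -rees_monomial0 => /rees_monomial_inj [_ sum0].
  have /eqP := primitive_vector_neq0 (prim _ alpha_in); apply.
  have /eqP b0 : b == 0%N by rewrite -leqn0 -sum0.
  apply/rowP; apply: eq_on_lift_max => [i|]; rewrite !mxE ?extend_max ?b0 //.
  rewrite extend_lift; congr Posz; apply/eqP; rewrite -leqn0 -sum0.
  by rewrite (bigD1 i) //= leq_addr.
move=> [_ [_ [[[u [k ->]] [v [l ->]]] [Su Sv] [u_n1 v_n1]]]].
rewrite rees_monomialM => /rees_monomial_inj [/mnmP betaD kD].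
move: Su Sv => /symbolic_rees_cone [le_k le_kC] /symbolic_rees_cone [le_l le_lC].
have aD i : a i = (u (lift ord_max i) + v (lift ord_max i))%N.
  by rewrite -betaE betaD mnmDE.
have maxD : (\sum_i a i - b)%N = (u ord_max + v ord_max)%N.
  by rewrite -beta_max betaD mnmDE.
have sumD : (\sum_i a i =
    \sum_i u (lift ord_max i) + \sum_i v (lift ord_max i))%N.
  by rewrite -big_split; apply: eq_bigr => i _; rewrite aD.
(* The pairing of this vector with (u, 1), for u the incidence vector of a cover C, is the excess
   over e of the weight of w on C and the new vertex. *)
pose normal (w : 'X_{1..n.+1}) (e : nat) : 'rV[int]_n.+1 :=
  \row_j extend (fun i => (w (lift ord_max i))%:Z) ((w ord_max)%:Z - e%:Z) j.
have normal_ge0 (w : 'X_{1..n.+1}) e : (forall C, vertex_cover G C ->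
      (e <= w ord_max + \sum_(i in C) w (lift ord_max i))%N) ->
    forall y, cover_rees_cone R G y -> 0 <= dot y (map_mx intr (normal w e)).
  move=> le_e; apply/cover_rees_cone_dual => C /le_e; lia.
(* The first n entries being 0, the equation for e gives e = 0, and then the last entry gives
   w_{n+1} = 0. *)
have normal_eq0 (w : 'X_{1..n.+1}) e :
    e = (\sum_i w (lift ord_max i))%N -> normal w e = 0 ->
    rees_monomial K w e = 1.
  move=> eE /rowP w0.
  have wi i : w (lift ord_max i) = 0%N.
    by have := w0 (lift ord_max i); rewrite !mxE extend_lift => -[].
  have e0 : e = 0%N by rewrite eE big1.
  have wmax : w ord_max = 0%N.
    by have := w0 ord_max; rewrite !mxE extend_max e0 subr0 => -[].
  rewrite -rees_monomial0 e0; congr rees_monomial.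
  by apply/mnmP; apply: eq_on_lift_max => [i|]; rewrite mnm0E.
have alE : al = normal u k + normal v l.
  apply/rowP; apply: eq_on_lift_max => [i|]; rewrite !mxE ?extend_lift ?extend_max.
    by rewrite aD.
  (* By [le_bT] the subtraction in [maxD] is not truncated. *)
  lia.
have [z zP] := cover_rees_cone_interior R G.
have [] := irreducible_representation_indecomposable irred zP alpha_in alE
  (normal_ge0 _ _ le_kC) (normal_ge0 _ _ le_lC).
  (* By [kD] and [sumD] the two sides of [le_k] and [le_l] have equal totals, so both inequalities
     are equalities. *)
  by move/normal_eq0 => u1; apply/u_n1/u1; lia.
by move/normal_eq0 => v1; apply/v_n1/v1; lia.
Qed.
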